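(* Any unital hyperarchimedean vector lattice is $a$-closed in $\mathsf{uVL}$. That is, if $(V,u)$ is a unital vector lattice with $V$ hyperarchimedean, then every $a$-extension $\iota\colon(V,u)\hookrightarrow(V',u')$ in $\mathsf{uVL}$ is an isomorphism.
   Context: A vector lattice is a lattice-ordered real vector space. A weak unit of $V$ is $u\ge0$ in $V$ such that $u\wedge v=0$ implies $v=0$ for all $v\in V$; a strong unit is $u\ge 0$ such that every $v\ge0$ in $V$ satisfies $v\le nu$ for some positive integer $n$. $\mathsf{uVL}$ is the category of pairs $(V,u)$, $V$ a vector lattice and $u$ a distinguished weak unit of $V$ that is strong, with morphisms the linear lattice homomorphisms preserving the distinguished units. $V$ is Archimedean if $0<v\le w$ implies $nv\not\le w$ for some positive integer $n$; it is hyperarchimedean if all of its homomorphic images are Archimedean. A unital hyperarchimedean vector lattice is a hyperarchimedean vector lattice with a distinguished weak unit; such a unit is automatically strong. For $(V,u)$ in $\mathsf{uVL}$, an ideal is an order-convex sublattice subgroup of $V$; a proper ideal $\mathfrak{p}$ is prime if $V/\mathfrak{p}$ is totally ordered. $\mathbf{Spec}\,V$ is the set of prime ideals, topologized by taking as basis of closed sets the sets $\{\mathfrak{p}\mid \mathfrak{p}\supseteq P\}$ for $P$ a principal ideal. A morphism $h\colon(V,u)\to(V',u')$ induces the dual continuous map $h^*\colon\mathbf{Spec}\,V'\to\mathbf{Spec}\,V$, $h^*(\mathfrak{p})=h^{-1}(\mathfrak{p})$. A monomorphism (equivalently, injective morphism) $\iota\colon(V,u)\hookrightarrow(V',u')$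 in $\mathsf{uVL}$ is an $a$-extension of $(V,u)$ if $\iota^*$ is a bijection. $(V,u)$ is $a$-closed in $\mathsf{uVL}$ if each $a$-extension of $(V,u)$ is an isomorphism. *)

(* Defs.v *)
From HB Require Import structures.
From mathcomp Require Import all_boot all_order all_algebra.
From mathcomp Require Import all_classical all_reals.

Set Implicit Arguments.
Unset Strict Implicit.
Unset Printing Implicit Defensive.

Import Order.LTheory GRing.Theory Num.Theory.
Local Open Scope order_scope.
Local Open Scope quotient_scope.
Local Open Scope ring_scope.

(* The lattice operations are fields of this mixin, and the [latticeType]
   instance is derived below: Hierarchy-Builder rejects a direct join of
   [GRing.Zmodule] and [Order.Lattice], because [Num.RealDomain], already
   declared, inherits from both. *)
HB.mixin Record POrderedLmodule_isVectorLattice (R : realType) V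
    of GRing.Lmodule R V & Num.POrderedZmodule V := {
  vl_meet : V -> V -> V;
  vl_join : V -> V -> V;
  vl_meetP : forall x y z : V, (x <= vl_meet y z) = (x <= y) && (x <= z);
  vl_joinP : forall x y z : V, (vl_join x y <= z) = (x <= z) && (y <= z);
  vl_leD2r : forall z x y : V, x <= y -> x + z <= y + z;
  vl_leZ : forall (a : R) (x y : V), 0 <= a -> x <= y -> a *: x <= a *: y
}.

#[short(type="vectorLatticeType")]
HB.structure Definition VectorLattice (R : realType) :=
  { V of GRing.Lmodule R V & Num.POrderedZmodule V
       & POrderedLmodule_isVectorLattice R V }.

HB.instance Definition _ (R : realType) (V : vectorLatticeType R) :=
  Order.POrder_MeetJoin_isLattice.Build ring_display (VectorLattice.sort V)
    (@vl_meetP R V) (@vl_joinP R V).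

(* In [order_scope], [`&`] binds tighter than [+], but [`|`] binds looser. *)
Section BasicTheory.
Context {R : realType} {V : vectorLatticeType R}.
Implicit Types (x y z v w : V) (a : R) (n : nat).

Lemma vl_leD2rE z x y : (x + z <= y + z) = (x <= y).
Proof.
apply/idP/idP => [/(vl_leD2r (- z))|]; last exact: vl_leD2r.
by rewrite !addrK.
Qed.

Lemma vl_leD2lE z x y : (z + x <= z + y) = (x <= y).
Proof. by rewrite ![z + _]addrC vl_leD2rE. Qed.

Lemma vl_leD x y z w : x <= y -> z <= w -> x + z <= y + w.
Proof.
move=> xy zw; apply: (@le_trans _ _ (y + z)).
  by rewrite vl_leD2rE.
by rewrite vl_leD2lE.
Qed.

Lemma vl_subr_ge0 x y : (0 <= x - y) = (y <= x).
Proof. by rewrite -[LHS](vl_leD2rE y) add0r subrK. Qed.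

Lemma vl_leBlDr x y z : (x - y <= z) = (x <= z + y).
Proof. by rewrite -[LHS](vl_leD2rE y) subrK. Qed.

Lemma vl_leBrDr x y z : (x <= y - z) = (x + z <= y).
Proof. by rewrite -[LHS](vl_leD2rE z) subrK. Qed.

Lemma vl_leN2 x y : (- x <= - y) = (y <= x).
Proof. by rewrite -[LHS]vl_subr_ge0 opprK addrC vl_subr_ge0. Qed.

Lemma vl_addr_ge0 x y : 0 <= x -> 0 <= y -> 0 <= x + y.
Proof. by move=> x0 y0; rewrite -[0]addr0 vl_leD. Qed.

Lemma vl_mulrn_ge0 x n : 0 <= x -> 0 <= x *+ n.
Proof.
by move=> x0; elim: n => [|n IH]; rewrite ?mulr0n // mulrS vl_addr_ge0.
Qed.

Lemma vl_leMn2r n x y : x <= y -> x *+ n <= y *+ n.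
Proof. by move=> xy; elim: n => [|n IH]; rewrite ?mulr0n // !mulrS vl_leD. Qed.

Lemma vl_leMn2l x m n : 0 <= x -> (m <= n)%N -> x *+ m <= x *+ n.
Proof.
move=> x0 mn; rewrite -(subnK mn) mulrnDr -[leLHS]add0r.
by rewrite vl_leD2rE vl_mulrn_ge0.
Qed.

Lemma vl_scaler_ge0 a x : 0 <= a -> 0 <= x -> 0 <= a *: x.
Proof. by move=> a0 /(vl_leZ _ _ _ a0); rewrite scaler0. Qed.

Lemma vl_meetDr x y z : (x + z) `&` (y + z) = x `&` y + z.
Proof.
apply/le_anti/andP; split.
  by rewrite -vl_leBlDr lexI !vl_leBlDr leIl leIr.
by rewrite lexI !vl_leD2rE leIl leIr.
Qed.

Lemma vl_joinDr x y z : (x + z) `|` (y + z) = (x `|` y) + z.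
Proof.
apply/le_anti/andP; split.
  by rewrite leUx !vl_leD2rE leUl leUr.
by rewrite -vl_leBrDr leUx !vl_leBrDr leUl leUr.
Qed.

Lemma vl_meetZ a x y : 0 <= a -> a *: (x `&` y) = (a *: x) `&` (a *: y).
Proof.
rewrite le_eqVlt => /predU1P[<-|a0]; first by rewrite !scale0r meetxx.
have aV0 : 0 <= a^-1 by rewrite invr_ge0 ltW.
apply/le_anti/andP; split.
  by rewrite lexI !vl_leZ ?leIl ?leIr // ltW.
rewrite -[leLHS]scale1r -(@mulfV _ a) ?gt_eqF // -scalerA vl_leZ ?(ltW a0) //.
have e z : z = a^-1 *: (a *: z) by rewrite scalerA mulVf ?gt_eqF ?scale1r.
by rewrite lexI {2}(e x) {3}(e y) !vl_leZ ?leIl ?leIr.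
Qed.

Definition vl_abs x := x `|` - x.

Lemma vl_ler_abs x : x <= vl_abs x. Proof. exact: leUl. Qed.

Lemma vl_lerN_abs x : - x <= vl_abs x. Proof. exact: leUr. Qed.

Lemma vl_half x : 2^-1 *: (x + x) = x.
Proof. by rewrite -mulr2n -scaler_nat scalerA mulVf ?scale1r ?pnatr_eq0. Qed.

Lemma vl_abs_ge0 x : 0 <= vl_abs x.
Proof.
rewrite -[vl_abs x]vl_half vl_scaler_ge0 ?invr_ge0 ?ler0n //.
by rewrite -(subrr x) vl_leD ?vl_ler_abs ?vl_lerN_abs.
Qed.

Lemma vl_scale_abs a x : a *: x <= `|a| *: vl_abs x.
Proof.
case: (ger0P a) => a0; first by rewrite vl_leZ ?vl_ler_abs.
rewrite -[leLHS]opprK -scalerN -scaleNr.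
by rewrite vl_leZ ?vl_lerN_abs // oppr_ge0 ltW.
Qed.

Lemma vl_le_abs_sub x z v : 0 <= v -> x <= z + (vl_abs (x - z) + v).
Proof.
move=> v0; rewrite -[leLHS](subrK z) addrC vl_leD2lE -[leLHS]addr0.
by rewrite vl_leD ?vl_ler_abs.
Qed.

Lemma vl_absB x y : vl_abs (x - y) = vl_abs (y - x).
Proof. by rewrite /vl_abs !opprB joinC. Qed.

Lemma vl_meet_sub x y z w :
  x `&` y - z `&` w <= vl_abs (x - z) + vl_abs (y - w).
Proof.
rewrite vl_leBlDr addrC -vl_meetDr lexI.
rewrite (le_trans (leIl _ _)) ?vl_le_abs_sub ?vl_abs_ge0 //=.
rewrite (le_trans (leIr _ _)) // [vl_abs _ + _]addrC.
by rewrite vl_le_abs_sub ?vl_abs_ge0.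
Qed.

Lemma vl_join_sub x y z w :
  (x `|` y) - (z `|` w) <= vl_abs (x - z) + vl_abs (y - w).
Proof.
rewrite vl_leBlDr addrC -vl_joinDr leUx.
rewrite (le_trans _ (leUl _ _)) ?vl_le_abs_sub ?vl_abs_ge0 //=.
rewrite (le_trans _ (leUr _ _)) // [vl_abs _ + _]addrC.
by rewrite vl_le_abs_sub ?vl_abs_ge0.
Qed.

Lemma vl_abs_le x y : x <= y -> - x <= y -> vl_abs x <= y.
Proof. by rewrite leUx => -> ->. Qed.

Lemma vl_absB_le x y : vl_abs (x - y) <= vl_abs x + vl_abs y.
Proof.
apply: vl_abs_le; first by rewrite vl_leD ?vl_ler_abs ?vl_lerN_abs.
by rewrite opprB addrC vl_leD ?vl_ler_abs ?vl_lerN_abs.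
Qed.

Lemma vl_absI_le x y : vl_abs (x `&` y) <= vl_abs x + vl_abs y.
Proof.
apply: vl_abs_le.
  by rewrite -[leLHS]addr0 vl_leD ?vl_abs_ge0 // (le_trans (leIl _ _)) ?leUl.
rewrite -[leRHS]opprK vl_leN2 lexI opprD; apply/andP; split.
  by rewrite -[leRHS]addr0 vl_leD // -vl_leN2 opprK ?oppr0 ?vl_lerN_abs ?vl_abs_ge0.
by rewrite -[leRHS]add0r vl_leD // -vl_leN2 opprK ?oppr0 ?vl_lerN_abs ?vl_abs_ge0.
Qed.

Lemma vl_oppU x y : - (x `|` y) = (- x) `&` (- y).
Proof.
apply/le_anti; rewrite lexI !vl_leN2 leUl leUr /=.
rewrite -vl_leN2 opprK leUx; apply/andP; split.
  by rewrite -[leLHS]opprK vl_leN2 leIl.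
by rewrite -[leLHS]opprK vl_leN2 leIr.
Qed.

Lemma vl_absU_le x y : vl_abs (x `|` y) <= vl_abs x + vl_abs y.
Proof.
have := vl_absI_le (- x) (- y).
by rewrite -vl_oppU /vl_abs !opprK joinC [- x `|` x]joinC [- y `|` y]joinC.
Qed.

Lemma vl_pos_neg x : (x `|` 0) `&` (- x `|` 0) = 0.
Proof.
have -> : x `|` 0 = x + (- x `|` 0).
  by rewrite [RHS]addrC -vl_joinDr addNr add0r joinC.
rewrite -{2}[- x `|` 0]add0r vl_meetDr.
have -> : x `&` 0 = - (- x `|` 0) by rewrite vl_oppU opprK oppr0.
by rewrite addNr.
Qed.

Lemma vl_disjointMn x y n : 0 <= x -> 0 <= y -> x `&` y = 0 -> x `&` (y *+ n) = 0.
Proof.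
move=> x0 y0 xy; elim: n => [|n IH]; first by rewrite mulr0n; exact: meet_r.
apply/le_anti; rewrite [X in _ && X]lexI x0 vl_mulrn_ge0 // andbT.
rewrite -[leRHS]IH lexI leIl /= -[leRHS]add0r -vl_leBlDr -xy lexI !vl_leBlDr.
rewrite -mulrS leIr !andbT (le_trans (leIl _ _)) //.
by rewrite -[leLHS]addr0 vl_leD ?vl_mulrn_ge0.
Qed.

End BasicTheory.

Definition lattice_hom (R : realType) (V W : vectorLatticeType R)
    (f : V -> W) : Prop :=
  {morph f : x y / x `&` y} /\ {morph f : x y / x `|` y}.

Lemma lattice_hom_le (R : realType) (V W : vectorLatticeType R) (f : V -> W) :
  lattice_hom f -> {homo f : x y / x <= y}.
Proof. by move=> [fI _] x y /meet_l <-; rewrite fI leIr. Qed.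

Section Units.
Context {R : realType} {V : vectorLatticeType R}.

Definition weak_unit (u : V) : Prop :=
  0 <= u /\ forall v : V, u `&` v = 0 -> v = 0.

Definition strong_unit (u : V) : Prop :=
  0 <= u /\ forall v : V, 0 <= v -> exists2 n, (0 < n)%N & v <= u *+ n.

End Units.

Definition archimedean (R : realType) (V : vectorLatticeType R) : Prop :=
  forall v w : V, 0 < v -> v <= w ->
    exists2 n, (0 < n)%N & ~ (v *+ n <= w).

Definition hyperarchimedean (R : realType) (V : vectorLatticeType R) : Prop :=
  forall (W : vectorLatticeType R) (f : {linear V -> W}),
    lattice_hom f -> (forall w, exists v, f v = w) -> archimedean W.

Section Ideals.
Context {R : realType} {V : vectorLatticeType R}.

(* Closure under scaling is a consequence: see [idealZ]. *)
Definition is_ideal (I : V -> Prop) : Prop :=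
  [/\ I 0 /\ (forall x y, I x -> I y -> I (x - y)),
      forall x y, I x -> I y -> I (x `&` y),
      forall x y, I x -> I y -> I (x `|` y)
    & forall x y z, I x -> I z -> x <= y -> y <= z -> I y].

Record ideal := Ideal { ideal_set :> V -> Prop; idealP : is_ideal ideal_set }.

Lemma is_ideal_solid (I : V -> Prop) :
  I 0 -> (forall x y z, I x -> I y -> vl_abs z <= vl_abs x + vl_abs y -> I z) ->
  is_ideal I.
Proof.
move=> I0 solid; split; first split=> //.
- by move=> x y Ix Iy; exact: solid Ix Iy (vl_absB_le _ _).
- by move=> x y Ix Iy; exact: solid Ix Iy (vl_absI_le _ _).
- by move=> x y Ix Iy; exact: solid Ix Iy (vl_absU_le _ _).
move=> x y z Ix Iz xy yz; apply: solid Ix Iz _; apply: vl_abs_le.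
  rewrite -[leLHS]add0r vl_leD ?vl_abs_ge0 //.
  exact: le_trans yz (vl_ler_abs _).
rewrite -[leLHS]addr0 vl_leD ?vl_abs_ge0 //.
by rewrite (le_trans _ (vl_lerN_abs _)) // vl_leN2.
Qed.

End Ideals.
Arguments ideal {R} V.

Section IdealTheory.
Context {R : realType} {V : vectorLatticeType R} (I : ideal V).
Implicit Types (x y z : V).

Lemma ideal0 : I 0. Proof. by case: (idealP I) => -[]. Qed.

Lemma idealB x y : I x -> I y -> I (x - y).
Proof. by case: (idealP I) => -[_ +] _ _ _; exact. Qed.

Lemma idealI x y : I x -> I y -> I (x `&` y).
Proof. by case: (idealP I) => _ + _ _; exact. Qed.

Lemma idealU x y : I x -> I y -> I (x `|` y).
Proof. by case: (idealP I) => _ _ + _; exact. Qed.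

Lemma ideal_convex x y z : I x -> I z -> x <= y -> y <= z -> I y.
Proof. by case: (idealP I) => _ _ _; exact. Qed.

Lemma idealN x : I x -> I (- x).
Proof. by rewrite -[- x]add0r; apply: idealB; exact: ideal0. Qed.

Lemma idealD x y : I x -> I y -> I (x + y).
Proof. by move=> Ix Iy; rewrite -[y]opprK; apply/idealB/idealN. Qed.

Lemma idealMn x n : I x -> I (x *+ n).
Proof.
move=> Ix; elim: n => [|n IH]; first by rewrite mulr0n; exact: ideal0.
by rewrite mulrS; exact: idealD.
Qed.

Lemma ideal_abs x : I x -> I (vl_abs x).
Proof. by move=> Ix; apply/idealU/idealN. Qed.

Lemma ideal_between x y : I y -> x <= y -> - x <= y -> I x.
Proof.
move=> Iy xy nxy; apply: (@ideal_convex (- y) x y) => //; first exact: idealN.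
by rewrite -vl_leN2 opprK.
Qed.

Lemma idealZ (a : R) x : I x -> I (a *: x).
Proof.
move=> Ix; pose n := Num.bound `|a|.
have an : `|a| *: vl_abs x <= vl_abs x *+ n.
  rewrite -scaler_nat -vl_subr_ge0 -scalerBl vl_scaler_ge0 ?vl_abs_ge0 //.
  by rewrite subr_ge0 ltW // archi_boundP.
apply: (@ideal_between _ (vl_abs x *+ n)); first exact/idealMn/ideal_abs.
  exact: le_trans (vl_scale_abs _ _) an.
by rewrite -scaleNr (le_trans (vl_scale_abs _ _)) // normrN.
Qed.

Definition ideal_pred : {pred V} := fun x => `[< I x >].

Lemma ideal_predP x : reflect (I x) (x \in ideal_pred).
Proof. exact: asboolP. Qed.

Lemma ideal_pred_zmod_closed : zmod_closed ideal_pred.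
Proof.
split; first exact/ideal_predP/ideal0.
by move=> x y /ideal_predP Ix /ideal_predP Iy; exact/ideal_predP/idealB.
Qed.

HB.instance Definition _ :=
  GRing.isZmodClosed.Build V ideal_pred ideal_pred_zmod_closed.

End IdealTheory.

(* The order of the quotient vector lattice [V / I] is defined from the induced
   meet, by [x <= y := x `&` y == x]. *)
Definition ideal_quot (R : realType) (V : vectorLatticeType R) (I : ideal V) :=
  Quotient.quot (ideal_pred I).

Section IdealQuotient.
Context {R : realType} {V : vectorLatticeType R} (I : ideal V).
Local Notation Q := (ideal_quot I).

HB.instance Definition _ := GRing.Zmodule.on Q.
HB.instance Definition _ := EqQuotient.on Q.

Lemma ideal_quot_eq (x y : V) : reflect (I (x - y)) (x == y %[mod Q]).
Proof. by rewrite -Quotient.idealrBE; exact: ideal_predP. Qed.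

Lemma ideal_quotE (x y : V) : I (x - y) -> \pi_Q x = \pi_Q y.
Proof. by move=> /ideal_quot_eq/eqP. Qed.

Lemma ideal_repr (x : V) : I (repr (\pi_Q x) - x).
Proof. by apply/ideal_quot_eq; rewrite reprK. Qed.

Lemma pi_idealD (x y : V) : \pi_Q (x + y) = \pi_Q x + \pi_Q y.
Proof. by rewrite !piE. Qed.

Definition ideal_quot_scale (a : R) := lift_op1 Q (fun x => a *: x).
Definition ideal_quot_meet := lift_op2 Q (fun x y => x `&` y).
Definition ideal_quot_join := lift_op2 Q (fun x y => x `|` y).

Local Notation sc := ideal_quot_scale.
Local Notation mt := ideal_quot_meet.
Local Notation jn := ideal_quot_join.

Lemma pi_idealZ a (x : V) : \pi_Q (a *: x) = sc a (\pi_Q x).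
Proof.
unlock ideal_quot_scale; apply: ideal_quotE; rewrite -scalerBr; apply: idealZ.
by rewrite -opprB; exact/idealN/ideal_repr.
Qed.

Lemma pi_idealI (x y : V) : \pi_Q (x `&` y) = mt (\pi_Q x) (\pi_Q y).
Proof.
unlock ideal_quot_meet; apply/esym/ideal_quotE; apply: ideal_between (vl_meet_sub _ _ _ _) _.
  by apply/idealD; exact/ideal_abs/ideal_repr.
rewrite opprB (le_trans (vl_meet_sub _ _ _ _)) //.
by rewrite vl_absB [in leLHS](vl_absB y).
Qed.

Lemma pi_idealU (x y : V) : \pi_Q (x `|` y) = jn (\pi_Q x) (\pi_Q y).
Proof.
unlock ideal_quot_join; apply/esym/ideal_quotE; apply: ideal_between (vl_join_sub _ _ _ _) _.
  by apply/idealD; exact/ideal_abs/ideal_repr.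
rewrite opprB (le_trans (vl_join_sub _ _ _ _)) //.
by rewrite vl_absB [in leLHS](vl_absB y).
Qed.

Lemma sc_assoc (a b : R) (q : Q) : sc a (sc b q) = sc (a * b) q.
Proof. by elim/quotW: q => x; rewrite -!pi_idealZ scalerA. Qed.

Lemma sc_1 : left_id 1 sc.
Proof. by elim/quotW => x; rewrite -!pi_idealZ scale1r. Qed.

Lemma sc_Dr : right_distributive sc +%R.
Proof.
move=> a; elim/quotW => x; elim/quotW => y.
by rewrite -!(pi_idealD, pi_idealZ) scalerDr.
Qed.

Lemma sc_Dl (q : Q) : {morph sc^~ q : a b / a + b}.
Proof.
move=> a b; elim/quotW: q => x.
by rewrite -!(pi_idealD, pi_idealZ) scalerDl.
Qed.

HB.instance Definition _ :=
  GRing.Zmodule_isLmodule.Build R Q sc_assoc sc_1 sc_Dr sc_Dl.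

Lemma mt_xx : idempotent_op mt.
Proof. by elim/quotW => x; rewrite -!pi_idealI meetxx. Qed.

Lemma jn_xx : idempotent_op jn.
Proof. by elim/quotW => x; rewrite -!pi_idealU joinxx. Qed.

Lemma mtC : commutative mt.
Proof. by elim/quotW => x; elim/quotW => y; rewrite -!pi_idealI meetC. Qed.

Lemma jnC : commutative jn.
Proof. by elim/quotW => x; elim/quotW => y; rewrite -!pi_idealU joinC. Qed.

Lemma mtA : associative mt.
Proof.
elim/quotW => x; elim/quotW => y; elim/quotW => z.
by rewrite -!pi_idealI meetA.
Qed.

Lemma jnA : associative jn.
Proof.
elim/quotW => x; elim/quotW => y; elim/quotW => z.
by rewrite -!pi_idealU joinA.
Qed.

Lemma mt_jnK (p q : Q) : mt p (jn p q) = p.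
Proof.
by elim/quotW: p => x; elim/quotW: q => y; rewrite -pi_idealU -pi_idealI joinKI.
Qed.

Lemma jn_mtK (p q : Q) : jn p (mt p q) = p.
Proof.
by elim/quotW: p => x; elim/quotW: q => y; rewrite -pi_idealI -pi_idealU meetKU.
Qed.

Definition ideal_quot_le (p q : Q) := mt p q == p.

Lemma ideal_quot_le_refl : reflexive ideal_quot_le.
Proof. by move=> p; rewrite /ideal_quot_le mt_xx. Qed.

Lemma ideal_quot_le_anti : antisymmetric ideal_quot_le.
Proof. by move=> p q /andP[/eqP pq /eqP qp]; rewrite -pq mtC. Qed.

Lemma ideal_quot_le_trans : transitive ideal_quot_le.
Proof. by move=> q p r /eqP pq /eqP qr; rewrite /ideal_quot_le -pq -mtA qr. Qed.

HB.instance Definition _ := Order.Le_isPOrder.Build ring_display Q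
  ideal_quot_le_refl ideal_quot_le_anti ideal_quot_le_trans.

Lemma ideal_quot_leE (p q : Q) : (p <= q) = (mt p q == p).
Proof. by []. Qed.

Lemma mtP (p q r : Q) : (p <= mt q r) = (p <= q) && (p <= r).
Proof.
rewrite !ideal_quot_leE; apply/eqP/andP => [pqr|[/eqP pq /eqP pr]].
  rewrite -pqr; split; first by rewrite -!mtA [mt r q]mtC [mt q (mt q r)]mtA mt_xx.
  by rewrite -!mtA mt_xx.
by rewrite mtA pq pr.
Qed.

Lemma ideal_quot_le_join (p q : Q) : (p <= q) = (jn p q == q).
Proof.
rewrite ideal_quot_leE; apply/eqP/eqP => <-; last exact: mt_jnK.
by rewrite jnC mtC jn_mtK.
Qed.

Lemma jnP (p q r : Q) : (jn p q <= r) = (p <= r) && (q <= r).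
Proof.
rewrite !ideal_quot_le_join; apply/eqP/andP => [pqr|[/eqP pr /eqP qr]].
  by split; rewrite -pqr !jnA ?jn_xx // [jn q p]jnC -[jn (jn p q) q]jnA jn_xx.
by rewrite -jnA qr pr.
Qed.

Lemma ideal_quot_leD2r (r p q : Q) : p <= q -> p + r <= q + r.
Proof.
rewrite !ideal_quot_leE => /eqP; elim/quotW: p => x; elim/quotW: q => y.
elim/quotW: r => z pq.
by rewrite -!pi_idealD -pi_idealI vl_meetDr !pi_idealD pi_idealI pq.
Qed.

Lemma ideal_quot_leZ (a : R) (p q : Q) : 0 <= a -> p <= q -> a *: p <= a *: q.
Proof.
rewrite !ideal_quot_leE => a0 /eqP.
elim/quotW: p => x; elim/quotW: q => y pq.
have piZ (z : V) : a *: (\pi_Q z) = \pi_Q (a *: z) by rewrite pi_idealZ.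
by rewrite !piZ -pi_idealI -vl_meetZ // -!piZ pi_idealI pq.
Qed.

HB.instance Definition _ :=
  Order.POrder_MeetJoin_isLattice.Build ring_display Q mtP jnP.
HB.instance Definition _ := POrderedLmodule_isVectorLattice.Build R Q
  mtP jnP ideal_quot_leD2r ideal_quot_leZ.

Definition ideal_proj (x : V) : Q := \pi_Q x.

Lemma ideal_proj_is_linear : linear ideal_proj.
Proof. by move=> a x y; rewrite /ideal_proj pi_idealD pi_idealZ. Qed.

HB.instance Definition _ :=
  GRing.isLinear.Build R V Q *:%R ideal_proj ideal_proj_is_linear.

Lemma ideal_proj_hom : lattice_hom ideal_proj.
Proof. by split=> x y; [exact: pi_idealI | exact: pi_idealU]. Qed.

Lemma ideal_proj_surj (q : Q) : exists x, ideal_proj x = q.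
Proof. by exists (repr q); exact: reprK. Qed.

Lemma ideal_proj_eq0 (x : V) : ideal_proj x = 0 <-> I x.
Proof.
rewrite -(linear0 ideal_proj) -[x in I x]subr0; split.
  by move=> /eqP/ideal_quot_eq.
exact: ideal_quotE.
Qed.

Lemma ideal_proj_leP (x y : V) :
  ideal_proj x <= ideal_proj y <-> I (x `&` y - x).
Proof.
rewrite ideal_quot_leE -pi_idealI.
by split=> [/ideal_quot_eq|?]; last exact/ideal_quot_eq.
Qed.

End IdealQuotient.

Section AutomaticStrongUnit.
Context {R : realType} {V : vectorLatticeType R}.

Let excess (u v : V) n := (u *+ n - v) `|` 0.

Let excess_ideal_set (u v : V) (x : V) : Prop :=
  exists N k, vl_abs x <= excess u v N *+ k.

Let excess_ideal (u v : V) : 0 <= u -> is_ideal (excess_ideal_set u v).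
Proof.
move=> u0; apply: is_ideal_solid.
  by exists 0, 0; rewrite mulr0n /vl_abs oppr0 joinxx.
have mono m n k : (m <= n)%N -> excess u v m *+ k <= excess u v n *+ k.
  by move=> mn; rewrite vl_leMn2r // leU2 // vl_leD2rE vl_leMn2l.
move=> x y z [N [k xNk]] [M [l yMl]] zxy; exists (maxn N M), (k + l)%N.
apply: le_trans zxy _; rewrite mulrnDr vl_leD //.
  by rewrite (le_trans xNk) // mono ?leq_maxl.
by rewrite (le_trans yMl) // mono ?leq_maxr.
Qed.

Lemma hyperarchimedean_strong_unit (u : V) :
  hyperarchimedean V -> weak_unit u -> strong_unit u.
Proof.
move=> hV [u0 uw]; split=> // v v0.
pose J := Ideal (excess_ideal v u0).
have archJ := hV _ (@ideal_proj _ _ J) (ideal_proj_hom J) (@ideal_proj_surj _ _ J).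
have pi_mono := lattice_hom_le (ideal_proj_hom J).
have excess_ge0 n : 0 <= excess u v n by exact: leUr.
have excessJ n : J (excess u v n).
  exists n, 1%N; rewrite mulr1n vl_abs_le //.
  by rewrite (le_trans _ (excess_ge0 n)) // -vl_leN2 opprK oppr0.
have nuv n : ideal_proj J u *+ n <= ideal_proj J v.
  rewrite -linearMn -[leRHS]add0r -vl_leBlDr -linearB.
  have /ideal_proj_eq0 := excessJ n.
  by rewrite (ideal_proj_hom J).2 linear0 => <-; exact: leUl.
have Ju : J u.
  apply: contrapT => nJu.
  have pu0 : 0 < ideal_proj J u.
    rewrite lt_neqAle -{2}(linear0 (ideal_proj J)) pi_mono // andbT.
    by apply/eqP => /esym/ideal_proj_eq0.
  have uv : ideal_proj J u <= ideal_proj J v by rewrite -[leLHS]mulr1n.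
  by have [n _] := archJ _ _ pu0 uv; apply.
have [N [k uNk]] := Ju.
have d0 : 0 <= (v - u *+ N) `|` 0 by exact: leUr.
have disj : ((v - u *+ N) `|` 0) `&` (excess u v N *+ k) = 0.
  apply: vl_disjointMn; rewrite ?leUr //.
  by rewrite meetC /excess -(opprB (u *+ N)); exact: vl_pos_neg.
exists N.+1 => //; apply: (@le_trans _ _ (u *+ N)); last exact: vl_leMn2l.
have <- : u *+ N + ((v - u *+ N) `|` 0) = u *+ N.
  rewrite [X in _ + X]uw ?addr0 //; apply/le_anti.
  rewrite [X in _ && X]lexI u0 d0 andbT -[leRHS]disj lexI leIr /=.
  by rewrite (le_trans (leIl _ _)) // (le_trans _ uNk) ?vl_ler_abs.
by rewrite addrC -vl_leBlDr leUl.
Qed.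

End AutomaticStrongUnit.

Definition prime_ideal (R : realType) (V : vectorLatticeType R) (p : ideal V) :
  Prop := (exists v, ~ p v) /\ total (<=%O : rel (ideal_quot p)).

(* Only the points: being an a-extension is a condition on the map of points
   underlying the dual continuous map. *)
Definition Spec (R : realType) (V : vectorLatticeType R) :=
  {p : ideal V | prime_ideal p}.

Record uVL (R : realType) := UVL {
  uVL_sort :> vectorLatticeType R;
  uVL_unit : uVL_sort;
  uVL_weak : weak_unit uVL_unit;
  uVL_strong : strong_unit uVL_unit }.

Record uVL_hom (R : realType) (A B : uVL R) := UVLHom {
  uVL_fun :> {linear A -> B};
  uVL_fun_hom : lattice_hom uVL_fun;
  uVL_fun_unit : uVL_fun (uVL_unit A) = uVL_unit B }.

Section Dual.
Context {R : realType} {A B : uVL R} (h : uVL_hom A B).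

Lemma preim_is_ideal (I : ideal B) : is_ideal (fun v => I (h v)).
Proof.
have [hI hU] := uVL_fun_hom h.
have hle := lattice_hom_le (uVL_fun_hom h).
split; first split; first by rewrite linear0; exact: ideal0.
- by move=> x y Ix Iy; rewrite linearB; exact: idealB.
- by move=> x y Ix Iy; rewrite hI; exact: idealI.
- by move=> x y Ix Iy; rewrite hU; exact: idealU.
- by move=> x y z Ix Iz /hle xy /hle yz; exact: ideal_convex xy yz.
Qed.

Definition preim_ideal (I : ideal B) : ideal A := Ideal (preim_is_ideal I).

Lemma preim_prime (p : ideal B) : prime_ideal p -> prime_ideal (preim_ideal p).
Proof.
move=> [[v npv] ptot]; split.
  exists (uVL_unit A); rewrite /= uVL_fun_unit => pu; apply: npv.
  have [_ /(_ _ (vl_abs_ge0 v))[n _ vn]] := uVL_strong B.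
  apply: (@ideal_between _ _ _ _ (uVL_unit B *+ n)); first exact: idealMn.
    exact: le_trans (vl_ler_abs _) vn.
  exact: le_trans (vl_lerN_abs _) vn.
move=> q r; have [x <-] := ideal_proj_surj q; have [y <-] := ideal_proj_surj r.
have [hI _] := uVL_fun_hom h.
apply/orP; have /orP[/ideal_proj_leP pxy|/ideal_proj_leP pyx] :=
  ptot (ideal_proj p (h x)) (ideal_proj p (h y)).
  by left; apply/ideal_proj_leP; rewrite /= linearB /= hI.
by right; apply/ideal_proj_leP; rewrite /= linearB /= hI.
Qed.

Definition Spec_dual (p : Spec B) : Spec A :=
  exist _ (preim_ideal (sval p)) (preim_prime (svalP p)).

Definition a_extension : Prop := injective h /\ bijective Spec_dual.

Definition uVL_iso : Prop :=
  exists g : uVL_hom B A, cancel h g /\ cancel g h.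

End Dual.

Definition a_closed (R : realType) (A : uVL R) : Prop :=
  forall (B : uVL R) (i : uVL_hom A B), a_extension i -> uVL_iso i.

(* Main.v *)
Require Import Defs.
From HB Require Import structures.
From mathcomp Require Import all_boot all_order all_algebra.
From mathcomp Require Import all_classical all_reals.

(* Primes of a hyperarchimedean [V] are maximal, so above each prime [p] of [V]
   the a-extension [B] has exactly one prime [m].  Every ideal of [B] is an
   intersection of primes, so every proper ideal containing the image of [p] is
   [m].  Hence [m] is generated by the image of [p] and closed under
   infinitesimals: any [w] in [B] satisfies |w - r u| <= x for some real [r] and
   some [x] in [p].  As [V] has a component of [u] disjoint from [x] and outside
   [p], [w] agrees with [r u] on an element outside [p].  The elements of [V] on
   which [w] agrees with some element of [V] form an ideal; it lies in no prime,
   so it contains [u], and [w] is in [V]. *)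

Set Implicit Arguments.
Unset Strict Implicit.
Unset Printing Implicit Defensive.

Import Order.TTheory GRing.Theory Num.Theory.
Local Open Scope order_scope.
Local Open Scope ring_scope.

(** * Absolute values, disjointness and polars *)

Section AbsoluteValue.
Context {R : realType} {V : vectorLatticeType R}.
Implicit Types (a b x y z : V).

Lemma vl_oppr_le0 x : (- x <= 0) = (0 <= x).
Proof. by rewrite -[RHS]vl_leN2 oppr0. Qed.

Lemma vl_ge0_abs x : 0 <= x -> vl_abs x = x.
Proof. by move=> x0; apply: join_l; rewrite (le_trans _ x0) ?vl_oppr_le0. Qed.

Lemma vl_abs0 : vl_abs (0 : V) = 0. Proof. exact: vl_ge0_abs. Qed.

Lemma vl_abs_eq0 x : vl_abs x = 0 -> x = 0.
Proof.
move=> x0; apply/le_anti; rewrite -{1}x0 vl_ler_abs /=.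
by rewrite -vl_oppr_le0 -x0 vl_lerN_abs.
Qed.

Lemma vl_absN x : vl_abs (- x) = vl_abs x.
Proof. by rewrite /vl_abs opprK joinC. Qed.

Lemma vl_absD_le x y : vl_abs (x + y) <= vl_abs x + vl_abs y.
Proof. by rewrite -{1}[y]opprK -(vl_absN y) vl_absB_le. Qed.

Lemma vl_meetD_le a x y :
  0 <= a -> 0 <= x -> 0 <= y -> a `&` (x + y) <= a `&` x + a `&` y.
Proof.
move=> a0 x0 y0; rewrite -vl_leBlDr lexI !vl_leBlDr.
have le2 (s t : V) : 0 <= t -> s <= s + t.
  by move=> t0; rewrite -[leLHS]addr0 vl_leD2lE.
rewrite (le_trans (leIl _ _)) ?le2 ?lexI ?a0 ?y0 //=.
rewrite [leRHS]addrC -vl_leBlDr lexI !vl_leBlDr.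
rewrite [a + x]addrC [y + x]addrC leIr andbT.
by rewrite (le_trans (leIl _ _)) // addrC le2.
Qed.

Definition disjoint x y := vl_abs x `&` vl_abs y = 0.

Lemma disjointC x y : disjoint x y -> disjoint y x.
Proof. by rewrite /disjoint meetC. Qed.

Lemma disjoint_self x : disjoint x x -> x = 0.
Proof. by rewrite /disjoint meetxx; exact: vl_abs_eq0. Qed.

Lemma disjoint_is_ideal a : is_ideal (disjoint a).
Proof.
apply: is_ideal_solid; first by rewrite /disjoint vl_abs0 meet_r ?vl_abs_ge0.
move=> x y z ax ay zxy; apply/le_anti.
rewrite [X in _ && X]lexI !vl_abs_ge0 andbT -[leRHS]addr0 -{1}ax -ay.
by rewrite (le_trans (leI2 (lexx _) zxy)) ?vl_meetD_le ?vl_abs_ge0.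
Qed.

Definition polar a : ideal V := Ideal (disjoint_is_ideal a).

Lemma ideal_solid (I : ideal V) x y : I y -> vl_abs x <= vl_abs y -> I x.
Proof.
move=> /ideal_abs Iy xy; apply: ideal_between Iy _ _.
  exact: le_trans (vl_ler_abs _) xy.
exact: le_trans (vl_lerN_abs _) xy.
Qed.

Lemma idealW (I : ideal V) x y : I y -> 0 <= x -> x <= y -> I x.
Proof. by move=> Iy; exact: ideal_convex (ideal0 I) Iy. Qed.

Lemma ideal_absE (I : ideal V) x : I (vl_abs x) <-> I x.
Proof.
split=> [Ix|]; last exact: ideal_abs.
by apply: ideal_solid Ix _; rewrite (vl_ge0_abs (vl_abs_ge0 _)).
Qed.

Lemma eq_ideal (I J : ideal V) : (forall x, I x <-> J x) -> I = J.
Proof.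
case: I J => [I I_] [J J_] /= IJ.
have E : I = J by apply/funext => x; exact/propext.
by case: J / E J_ {IJ} => J_; congr Ideal; exact: Prop_irrelevance.
Qed.

Lemma strong_unit_ideal u (I : ideal V) : strong_unit u -> I u -> forall v, I v.
Proof.
move=> [_ su] Iu v; have [n _ vn] := su _ (vl_abs_ge0 v).
exact/ideal_absE/(idealW (idealMn n Iu))/vn/vl_abs_ge0.
Qed.

End AbsoluteValue.

(** * Images under lattice homomorphisms *)

Section LatticeHom.
Context {R : realType} {V W : vectorLatticeType R} (f : {linear V -> W}).
Hypothesis hf : lattice_hom f.

Lemma lattice_hom_abs x : f (vl_abs x) = vl_abs (f x).
Proof. by rewrite /vl_abs hf.2 linearN. Qed.

Lemma lattice_hom_disjoint x y : disjoint x y -> disjoint (f x) (f y).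
Proof. by rewrite /disjoint -!lattice_hom_abs -hf.1 => ->; exact: linear0. Qed.

Lemma hyperarchimedean_image :
  (forall w, exists v, f v = w) -> hyperarchimedean V -> hyperarchimedean W.
Proof.
move=> fS hV X g hg gS; apply: (hV X (g \o f)%FUN) => [|x].
  by split=> x y /=; rewrite ?hf.1 ?hf.2 ?hg.1 ?hg.2.
by have [w <-] := gS x; have [v <-] := fS w; exists v.
Qed.

Lemma strong_unit_image u :
  (forall w, exists v, f v = w) -> strong_unit u -> strong_unit (f u).
Proof.
move=> fS [u0 su]; have mono := lattice_hom_le hf.
split=> [|w w0]; first by rewrite -(linear0 f) mono.
have [v vw] := fS w; have [n n0 vn] := su _ (vl_abs_ge0 v); exists n => //.
by rewrite -(vl_ge0_abs w0) -vw -lattice_hom_abs -linearMn mono.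
Qed.

End LatticeHom.

(** * Splitting along an element of a hyperarchimedean lattice *)

Section HyperarchimedeanComponent.
Context {R : realType} {V : vectorLatticeType R}.
Hypothesis hV : hyperarchimedean V.

(* In the hyperarchimedean quotient by the polar of [x], [x] is a weak unit,
   hence a strong one. *)
Lemma hyperarchimedean_component (x u : V) : 0 <= u ->
  exists n, disjoint x (u - u `&` (vl_abs x *+ n)).
Proof.
move=> u0; pose pi : {linear V -> ideal_quot (polar x)} :=
  @ideal_proj R V (polar x).
have pi_hom : lattice_hom pi := ideal_proj_hom (polar x).
have pi_surj : forall q, exists v, pi v = q := @ideal_proj_surj R V (polar x).
have mono := lattice_hom_le pi_hom.
have wx : weak_unit (pi (vl_abs x)).
  split=> [|q]; first by rewrite -(linear0 pi) mono ?vl_abs_ge0.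
  have [v <-] := pi_surj q => xv.
  have v0 : 0 <= pi v by rewrite -xv leIr.
  (* As [0 <= pi v], the positive part of [v] represents the same class. *)
  rewrite -(join_l v0) -(linear0 pi) -pi_hom.2 in xv *.
  have y0 : 0 <= v `|` 0 by exact: leUr.
  move: (v `|` 0) y0 xv => y y0.
  rewrite -pi_hom.1 linear0 => /ideal_proj_eq0; rewrite /= /disjoint.
  rewrite [vl_abs (_ `&` _)]vl_ge0_abs ?lexI ?vl_abs_ge0 // meetA meetxx => xy.
  by apply/ideal_proj_eq0; rewrite /= /disjoint (vl_ge0_abs y0).
have hQ := hyperarchimedean_image pi_hom pi_surj hV.
have [_ su] := hyperarchimedean_strong_unit hQ wx.
have [|n _] := su (pi u); first by rewrite -(linear0 pi) mono.
rewrite -linearMn => /ideal_proj_leP /idealN; rewrite opprB; by exists n.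
Qed.

(** So [V] is the sum of the ideal generated by [x] and the polar of [x]; quantifying over [I]
    stands in for the generated ideal. For positive [s], a truncation at a multiple of [vl_abs x]
    serves as [t]; the general case combines positive and negative parts. *)
Lemma hyperarchimedean_split (x s : V) :
  exists t, disjoint x (s - t) /\ forall I : ideal V, I x -> I t.
Proof.
have pos (y : V) : 0 <= y ->
    exists t, disjoint x (y - t) /\ forall I : ideal V, I x -> I t.
  move=> y0; have [n xn] := hyperarchimedean_component x y0.
  exists (y `&` (vl_abs x *+ n)); split=> // I Ix.
  apply: (idealW (idealMn n (ideal_abs Ix))); last exact: leIr.
  by rewrite lexI y0 vl_mulrn_ge0 ?vl_abs_ge0.
have -> : s = (s `|` 0) - (- s `|` 0).
  by apply/eqP; rewrite eq_sym subr_eq addrC -vl_joinDr addNr add0r joinC.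
have [t [xt tI]] := pos (s `|` 0) (leUr _ _).
have [t' [xt' tI']] := pos (- s `|` 0) (leUr _ _).
exists (t - t'); split=> [|I Ix]; last by apply: idealB; [exact: tI | exact: tI'].
have -> (a b c d : V) : a - b - (c - d) = (a - c) - (b - d).
  by rewrite !opprD !opprK !addrA; congr (_ + _); rewrite addrAC.
exact: (@idealB _ _ (polar x)) xt xt'.
Qed.

End HyperarchimedeanComponent.

(** * Prime ideals: separation and maximality *)

Section PrimeIdeals.
Context {R : realType} {V : vectorLatticeType R}.
Implicit Types (x y : V) (I J p q : ideal V).

(** In the totally ordered quotient, the smaller of the two absolute values equals their meet, which
    is 0. *)
Lemma prime_disjoint p x y : prime_ideal p -> disjoint x y -> p x \/ p y.
Proof.
move=> [_ ptot] xy.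
have /orP[] := ptot (ideal_proj p (vl_abs x)) (ideal_proj p (vl_abs y)).
  move=> /ideal_proj_leP; rewrite xy sub0r => /idealN; rewrite opprK.
  by move=> /ideal_absE; left.
move=> /ideal_proj_leP; rewrite meetC xy sub0r => /idealN; rewrite opprK.
by move=> /ideal_absE; right.
Qed.

(** This is the ideal generated by [I] and [a]. *)
Lemma adjoin_is_ideal I a : 0 <= a ->
  is_ideal (fun z => exists m n, I m /\ vl_abs z <= m + a *+ n).
Proof.
move=> a0; apply: is_ideal_solid.
  by exists 0, 0; split; [exact: ideal0 | rewrite vl_abs0 addr0].
move=> x y z [m [k [Im xm]]] [n [l [In yn]]] zxy.
exists (m + n), (k + l)%N; split; first exact: idealD.
by rewrite mulrnDr addrACA (le_trans zxy) // vl_leD.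
Qed.

(** An ideal [p] maximal among those containing [J] and missing [x] is prime: if [a] and [b] were
    incomparable modulo [p], their disjoint excesses over [a & b] would both lie outside [p], and
    adjoining either one would capture [x]. *)
Lemma prime_separation J x : ~ J x ->
  exists p, [/\ prime_ideal p, forall y, J y -> p y & ~ p x].
Proof.
move=> nJx.
(* Joining [J] to [A] lets the empty chain satisfy [P]. *)
pose P (A : set V) := is_ideal (fun y => A y \/ J y) /\ ~ A x.
have [|M [[idM nMx] maxM]] := @Zorn_bigcup V P.
  move=> F FP Ftot; split; last by move=> [A /FP[_ nAx] Ax].
  apply: is_ideal_solid; first by right; exact: ideal0.
  have union (A : set V) y z t : F A -> A y \/ J y -> A z \/ J z ->
      vl_abs t <= vl_abs y + vl_abs z -> (\bigcup_(X in F) X)%classic t \/ J t.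
    move=> FA Ay Az tyz; have [idA _] := FP _ FA.
    pose K := Ideal idA.
    have : K t.
      have Kyz : K (vl_abs y + vl_abs z) by apply/idealD; exact/ideal_abs.
      apply: ideal_solid Kyz _.
      by rewrite [leRHS]vl_ge0_abs // vl_addr_ge0 ?vl_abs_ge0.
    by move=> [At|]; [left; exists A | right].
  move=> y z t [[A FA Ay]|Jy] [[B FB Bz]|Jz].
  - have [AB|BA] := Ftot _ _ FA FB.
      by apply: (union B); [|left; exact: AB|left].
    by apply: (union A); [|left|left; exact: BA].
  - by apply: (union A); [|left|right].
  - by apply: (union B); [|right|left].
  move=> tyz; right.
  have Jyz : J (vl_abs y + vl_abs z) by apply/idealD; exact/ideal_abs.
  apply: ideal_solid Jyz _.
  by rewrite [leRHS]vl_ge0_abs // vl_addr_ge0 ?vl_abs_ge0.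
pose p := Ideal idM.
have npx : ~ p x by case.
have maxp a : 0 <= a -> ~ p a -> exists m n, p m /\ vl_abs x <= m + a *+ n.
  move=> a0 npa; pose K := Ideal (adjoin_is_ideal p a0).
  have pK y : p y -> K y.
    by move=> py; exists (vl_abs y), 0; rewrite addr0; split=> //; exact: ideal_abs.
  apply: contrapT => nKx; apply: (maxM K).
    split=> [y My|KM]; first by apply: pK; left.
    apply: npa; left; apply: KM; exists 0, 1%N.
    by rewrite add0r vl_ge0_abs //; split=> //; exact: ideal0.
  split=> //; suff -> : (fun y => K y \/ J y) = K by exact: idealP.
  apply/funext => y; apply/propext; split=> [[//|Jy]|]; last by left.
  by apply: pK; right.
exists p; split=> //; last by move=> y Jy; right.
split=> [|s t]; first by exists x.
have [a <-] := ideal_proj_surj s; have [b <-] := ideal_proj_surj t.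
apply: contrapT => /negP; rewrite negb_or => /andP[/negP ab /negP ba].
have dif_ge0 (c d : V) : 0 <= c - c `&` d by rewrite vl_subr_ge0 leIl.
have disj : (a - a `&` b) `&` (b - a `&` b) = 0 by rewrite vl_meetDr subrr.
have [m [k [pm xm]]] : exists m n, p m /\ vl_abs x <= m + (a - a `&` b) *+ n.
  apply: maxp (dif_ge0 _ _) _ => /idealN; rewrite opprB => pab.
  exact/ab/ideal_proj_leP.
have [n [l [pn xn]]] : exists m n, p m /\ vl_abs x <= m + (b - a `&` b) *+ n.
  rewrite meetC; apply: maxp (dif_ge0 _ _) _ => /idealN; rewrite opprB => pab.
  exact/ba/ideal_proj_leP.
have {}disj : ((a - a `&` b) *+ k) `&` ((b - a `&` b) *+ l) = 0.
  have b0 : 0 <= b - a `&` b by rewrite meetC.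
  apply: vl_disjointMn => //; first exact: vl_mulrn_ge0.
  by rewrite meetC; apply: vl_disjointMn => //; rewrite meetC.
(* Both bounds hold with [m] and [n] replaced by their join; the meet of the two bounds is that
   join, since the remaining summands are disjoint. *)
apply/npx/ideal_absE/(idealW (idealU pm pn)); first exact: vl_abs_ge0.
rewrite -[leRHS]add0r -disj -vl_meetDr lexI; apply/andP; split.
  by rewrite (le_trans xm) // addrC vl_leD2lE leUl.
by rewrite (le_trans xn) // addrC vl_leD2lE leUr.
Qed.

(** Take [z] outside [q] and [x] in [q], and split [z] along [x]. The part [t] is in [q], so [z - t]
    is not, hence is not in [p]; being disjoint from [x], it forces [x] into [p]. *)
Lemma hyperarchimedean_prime_maximal p q :
  hyperarchimedean V -> prime_ideal p ->
  (forall x, p x -> q x) -> (exists x, ~ q x) -> p = q.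
Proof.
move=> hV pP pq [z nqz]; apply: eq_ideal => x; split=> [/pq//|qx].
have [t [xz tI]] := hyperarchimedean_split hV x z.
case: (prime_disjoint pP xz) => // /pq qz; case: nqz.
by rewrite -[z](subrK t); exact: idealD qz (tI q qx).
Qed.

End PrimeIdeals.

(** * Standard parts and infinitesimals *)

Lemma total_standard_part (R : realType) (Q : vectorLatticeType R) (u w : Q) :
  total (<=%O : rel Q) -> strong_unit u -> u != 0 ->
  exists r : R, forall e : R, 0 < e -> vl_abs (w - r *: u) <= e *: u.
Proof.
move=> Qtot [u0 su] un0; pose S := [set s : R | s *: u <= w]%classic.
have mono (s t : R) : s <= t -> s *: u <= t *: u.
  by move=> st; rewrite -vl_subr_ge0 -scalerBl vl_scaler_ge0 // subr_ge0.
have [n _ wn] := su _ (vl_abs_ge0 w).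
have Sn : S (- n%:R).
  rewrite /S /= scaleNr scaler_nat -[w]opprK vl_leN2.
  exact: le_trans (vl_lerN_abs _) wn.
have ubS : ubound S n%:R.
  (* An [s] in [S] above [n] would give [(s - n) u <= 0], hence [u = 0]. *)
  move=> s /= sw; rewrite leNgt; apply/negP => ns; move/negP: un0; apply; apply/eqP.
  have : (s - n%:R) *: u <= 0.
    rewrite scalerBl vl_leBlDr add0r scaler_nat.
    exact: le_trans sw (le_trans (vl_ler_abs _) wn).
  have sn0 : 0 < s - n%:R by rewrite subr_gt0.
  move=> /(vl_leZ (s - n%:R)^-1).
  rewrite invr_ge0 (ltW sn0) scalerA mulVf ?gt_eqF // scale1r scaler0 => /(_ isT) ule.
  by apply/le_anti; rewrite ule u0.
have supS : has_sup S by split; [exists (- n%:R) | exists n%:R].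
exists (sup S) => e e0; apply: vl_abs_le; last first.
  rewrite opprB vl_leBlDr addrC -vl_leBlDr -scalerBl.
  have [s Ss es] := sup_adherent e0 supS.
  exact: le_trans (mono _ _ (ltW es)) Ss.
(* By totality, the failure of this bound would put [e + sup S] in [S]. *)
rewrite vl_leBlDr -scalerDl; have /orP[//|we] := Qtot w ((e + sup S) *: u).
have := sup_upper_bound supS we.
by rewrite gerDr leNgt e0.
Qed.

Section InfinitesimalIdeal.
Context {R : realType} {V : vectorLatticeType R} (p : ideal V) (u : V).
Hypothesis u0 : 0 <= u.

(** These are the elements infinitesimal relative to [u] modulo [p]. A prime containing this ideal
    will be shown to be the given prime itself, which therefore absorbs the error of a standard
    part. *)
Lemma infinitesimal_is_ideal : is_ideal (fun x => forall e : R, 0 < e ->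
  vl_abs (ideal_proj p x) <= e *: ideal_proj p u).
Proof.
have hom := ideal_proj_hom p; have mono := lattice_hom_le hom.
apply: is_ideal_solid.
  move=> e e0; rewrite linear0 vl_abs0 vl_scaler_ge0 ?(ltW e0) //.
  by rewrite -(linear0 (ideal_proj p)) mono.
move=> x y z Ix Iy zxy e e0; have e20 : 0 < e / 2 by rewrite divr_gt0.
rewrite [e]splitr scalerDl -lattice_hom_abs // (le_trans (mono _ _ zxy)) //.
by rewrite linearD /= !lattice_hom_abs // vl_leD ?Ix ?Iy.
Qed.

Definition infinitesimal : ideal V := Ideal infinitesimal_is_ideal.

End InfinitesimalIdeal.

(** * Surjectivity of an embedding that is bijective on spectra *)

Section SpectralBijection.
Context {R : realType} {A B : uVL R} (i : uVL_hom A B).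
Hypotheses (hA : hyperarchimedean A) (iB : bijective (Spec_dual i)).

Let hom := uVL_fun_hom i.

(** Surjectivity on spectra provides [m]. A prime [q] containing the image of [p] contracts to a
    proper ideal above [p], which is [p] by maximality; injectivity on spectra then gives
    [q = m]. *)
Lemma prime_lift (p : ideal A) : prime_ideal p ->
  exists m : ideal B, [/\ prime_ideal m, forall x, p x -> m (i x) &
    forall q : ideal B, prime_ideal q -> (forall x, p x -> q (i x)) -> q = m].
Proof.
case: iB => g iK gK pP; pose P : Spec A := exist _ p pP.
have pm : preim_ideal i (sval (g P)) = p := congr1 sval (gK P).
exists (sval (g P)); split=> [|x|q qP pq]; first exact: svalP.
  by rewrite -{1}pm.
have pq' : p = preim_ideal i q.
  by apply: hyperarchimedean_prime_maximal => //; case: (preim_prime i qP).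
have <- // : exist _ q qP = g P.
by rewrite -[LHS]iK; congr g; exact: eq_exist.
Qed.

(** This is the ideal of [B] generated by the image of [p]. *)
Lemma extension_is_ideal (p : ideal A) :
  is_ideal (fun z => exists y, p y /\ vl_abs z <= i y).
Proof.
apply: is_ideal_solid.
  by exists 0; rewrite vl_abs0 linear0; split=> //; exact: ideal0.
move=> x y z [a [pa xa]] [b [pb yb]] zxy; exists (a + b); split; first exact: idealD.
by rewrite linearD (le_trans zxy) // vl_leD.
Qed.

(* The only prime containing the extension of [p] is the prime [m] above [p], so
   [m] is that extension; it also contains the infinitesimals modulo [m]. *)
Lemma prime_extension_approx (p : ideal A) (w : B) : prime_ideal p ->
  exists (r : R) x, p x /\ vl_abs (w - r *: uVL_unit B) <= i x.
Proof.
move=> pP; have [m [mP pm mU]] := prime_lift pP.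
have [mprop mtot] := mP; have sB := uVL_strong B; have [u0 _] := sB.
have hm := ideal_proj_hom m.
have su := strong_unit_image hm (@ideal_proj_surj _ _ m) sB.
have nmu : ~ m (uVL_unit B).
  by move=> mu; case: mprop => v; apply; exact: strong_unit_ideal mu v.
have un0 : ideal_proj m (uVL_unit B) != 0 by apply/eqP => /ideal_proj_eq0.
have [r wr] := total_standard_part (ideal_proj m w) mtot su un0.
pose J := infinitesimal m u0.
have mJ x : m x -> J x.
  move=> /ideal_proj_eq0 mx e e0; rewrite mx vl_abs0 vl_scaler_ge0 ?(ltW e0) //.
  by case: su.
have nJu : ~ J (uVL_unit B).
  (* Taking [e] to be one half would give [2 u <= u] modulo [m], so [u] would vanish there. *)
  have [p0 _] := su.
  move=> /(_ 2^-1); rewrite invr_gt0 ltr0n => /(_ isT).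
  rewrite (vl_ge0_abs p0) => /(vl_leZ 2 _ _ (ler0n _ _)).
  rewrite scalerA divff ?pnatr_eq0 // scale1r scaler_nat mulr2n -vl_leBrDr subrr.
  by move=> ule; move/eqP: un0; apply; apply/le_anti; rewrite ule p0.
(* [q] contains [J], hence [m] and the image of [p], so [q = m] and the infinitesimals lie in
   [m]. *)
have [q [qP Jq _]] := prime_separation nJu.
have mwr : m (w - r *: uVL_unit B).
  rewrite -(mU q) => [| |x px]; [apply: Jq => e e0 | exact: qP | exact/Jq/mJ/pm].
  by rewrite linearB linearZ /=; exact: wr.
(* Otherwise some prime contains the extension of [p] but misses [w - r u]; that prime is again
   [m]. *)
apply: contrapT => nwr; pose K := Ideal (extension_is_ideal p).
have [|s [sP Ks]] := @prime_separation _ _ K (w - r *: uVL_unit B).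
  by move=> [x [px wx]]; apply: nwr; exists r, x.
rewrite (mU s) // => x px; apply: Ks; exists (vl_abs x).
by rewrite lattice_hom_abs //; split=> //; exact: ideal_abs.
Qed.

(** Closure under sums is a patching argument. If [w] agrees with [v] on [x] and with [v'] on [y],
    correct [v'] by the part [t] of [v - v'] along [x]: on [x] this restores [v], and on [y] the
    overlap with [x] causes no conflict. *)
Lemma agreement_is_ideal (w : B) :
  is_ideal (fun y => exists v, disjoint (i y) (w - i v)).
Proof.
apply: is_ideal_solid.
  by exists 0; rewrite linear0; apply: disjointC; exact: (ideal0 (polar _)).
move=> x y z [v xv] [v' yv] zxy.
have [t [xt tI]] := hyperarchimedean_split hA x (v - v').
exists (v' + t); apply: disjointC; set D := w - _.
have Dx : disjoint (i x) D.
  have -> : D = (w - i v) + i (v - v' - t).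
    by rewrite /D linearD !linearB /= opprD !addrA subrK.
  exact: (@idealD _ _ (polar (i x))) xv (lattice_hom_disjoint hom xt).
have Dy : disjoint D (i y).
  (* [c] is disjoint from [i x] because [D] is, hence from [i t]; lying below [vl_abs (i y)], it is
     also disjoint from [w - i v']. So it is disjoint from [D], which dominates it, and [c = 0]. *)
  pose c := vl_abs D `&` vl_abs (i y).
  have c0 : 0 <= c by rewrite lexI !vl_abs_ge0.
  have cS (I : ideal B) : I D \/ I (i y) -> I c.
    by move=> [] /ideal_abs Ic; apply: idealW Ic c0 _; [exact: leIl | exact: leIr].
  have cx : polar c (i x) by apply: disjointC; apply: (cS (polar _)); left.
  have ct : polar c (i t) by exact: (tI (preim_ideal i (polar c))).
  have cv : polar c (w - i v').
    apply: disjointC; apply: (cS (polar _)); right.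
    exact: disjointC.
  have cD : polar c D by rewrite /D linearD opprD addrA; exact: idealB.
  apply: disjoint_self; apply: (cS (polar c)); left; exact: cD.
apply: (@ideal_solid _ _ (polar D) (i z) (vl_abs (i x) + vl_abs (i y))).
  by apply: idealD; apply: ideal_abs => //; exact: disjointC.
rewrite [leRHS]vl_ge0_abs ?vl_addr_ge0 ?vl_abs_ge0 //.
by rewrite -!lattice_hom_abs // -linearD; exact: lattice_hom_le.
Qed.

Lemma spectral_bijection_surjective (w : B) : exists v, i v = w.
Proof.
pose G := Ideal (agreement_is_ideal w).
have [[v uv]|nGu] := pselect (G (uVL_unit A)).
  (* Agreement on a weak unit is equality. *)
  exists v; have [u0 uW] := uVL_weak B.
  move: uv; rewrite /disjoint uVL_fun_unit (vl_ge0_abs u0) => /uW.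
  by move=> /vl_abs_eq0/eqP; rewrite subr_eq0 => /eqP.
have [p [pP Gp npu]] := prime_separation nGu.
have [r [x [px wx]]] := prime_extension_approx w pP.
have [t [xt tI]] := hyperarchimedean_split hA x (uVL_unit A).
(* [t] lies in [p]. The image of [u - t] is disjoint from [i x], hence from [w - r u], so [w] agrees
   with [r u] on [u - t], which puts [u - t] in [p] as well. *)
case: npu; rewrite -[uVL_unit A](subrK t); apply: idealD (Gp _ _) (tI p px).
exists (r *: uVL_unit A); rewrite linearZ /= uVL_fun_unit.
apply: (@ideal_solid _ _ (polar (i (uVL_unit A - t))) _ (i x)).
  by apply: lattice_hom_disjoint; [|exact: disjointC].
exact: le_trans wx (vl_ler_abs _).
Qed.

End SpectralBijection.

(** * From bijections to isomorphisms, and the conclusion *)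

Lemma uVL_iso_bijective (R : realType) (A B : uVL R) (h : uVL_hom A B) :
  bijective h -> uVL_iso h.
Proof.
move=> [g hK gK].
have g_linear : linear g by move=> a x y; apply: (can_inj hK); rewrite linearP !gK.
pose gL : {linear B -> A} := HB.pack g (GRing.isLinear.Build R B A _ g g_linear).
have [hI hU] := uVL_fun_hom h.
have g_hom : lattice_hom gL.
  by split=> x y; apply: (can_inj hK); rewrite ?hI ?hU !gK.
have g_unit : gL (uVL_unit B) = uVL_unit A by rewrite -(uVL_fun_unit h) /= hK.
by exists (UVLHom g_hom g_unit).
Qed.

Theorem corollary6p2 (R : realType) (V : vectorLatticeType R) (u : V)
    (hV : hyperarchimedean V) (hu : weak_unit u) :
  a_closed (UVL hu (hyperarchimedean_strong_unit hV hu)).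
Proof.
move=> B i [i_inj iB]; apply: uVL_iso_bijective.
have i_surj := spectral_bijection_surjective (A := UVL hu _) hV iB.
have [g gK] := choice i_surj.
by exists g => // x; apply: i_inj.
Qed.
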